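(* Let $\mathcal G$ be the graph with vertex set $V=(\mathbb{N}\times\mathbb{N})\setminus\{(0,0)\}$ (where $\mathbb{N}=\{0,1,2,\dots\}$), in which two distinct vertices $(a,b),(c,d)$ are adjacent if and only if $a=c=0$, or $b=d=0$, or ($a<c$ and $b>d$), or ($a>c$ and $b<d$). Then $\mathcal G$ is cop-win. Furthermore, for any two vertices $u,v$ of $\mathcal G$ there exists $n\in\mathbb{N}$ such that if the cop starts at $v$ and the robber starts at $u$, the cop can catch the robber in at most $n$ turns. However, there is no $n\in\mathbb{N}$ such that this holds for all pairs of initial positions $u,v$.
   Context: The game of cops and robbers on a graph $G$: the cop chooses a starting vertex, then the robber chooses a starting vertex; then they alternately move, the cop moving first, where a move consists of moving to an adjacent vertex or staying put. The cop wins if at some point he occupies the same vertex as the robber. $G$ is cop-win if the cop has a winning strategy. *)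

(* Defs.v *)
From mathcomp Require Import all_boot.

Set Implicit Arguments.
Unset Strict Implicit.
Unset Printing Implicit Defensive.

Record sgraph := SGraph {
  vertex :> Type;
  adj : rel vertex;
  adj_sym : symmetric adj;
  adj_irr : irreflexive adj }.

Section CopsAndRobbers.

Variable G : sgraph.

Definition move (x y : G) : Prop := x = y \/ adj x y.

(* [r n] is the robber's position after his [n]-th move, [r 0] being his
   starting vertex. Since the cop strategies below are deterministic,
   quantifying over all such sequences covers every adaptive behaviour of the
   robber. *)
Definition robber_play (r : nat -> G) : Prop := forall n, move (r n) (r n.+1).

(* The cop's next vertex, as a function of the robber's positions so far in
   chronological order. The cop's own past positions are determined by these
   and by his starting vertex. *)
Definition cop_strategy := seq G -> G.

(* The cop moves first, so his [n.+1]-st move is made knowing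
   [r 0], ..., [r n]. *)
Definition cop_pos (c0 : G) (s : cop_strategy) (r : nat -> G) (n : nat) : G :=
  if n is m.+1 then s (mkseq r m.+1) else c0.

Definition legal (c0 : G) (s : cop_strategy) : Prop :=
  forall r, robber_play r ->
  forall n, move (cop_pos c0 s r n) (cop_pos c0 s r n.+1).

(* A turn is a cop move followed by a robber move. The players meet either at
   the end of turn [k] (or initially, if [k = 0]), or right after the cop's
   move in turn [k.+1]. *)
Definition caught_within (c0 : G) (s : cop_strategy) (r : nat -> G) (n : nat)
  : Prop :=
  exists k, (k <= n /\ cop_pos c0 s r k = r k) \/
            (k < n /\ cop_pos c0 s r k.+1 = r k).

Definition cop_win : Prop :=
  exists (c0 : G) (s : cop_strategy), legal c0 s /\
  forall r, robber_play r -> exists n, caught_within c0 s r n.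

Definition cop_can_catch_within (v u : G) (n : nat) : Prop :=
  exists s : cop_strategy, legal v s /\
  forall r, robber_play r -> r 0 = u -> caught_within v s r n.

End CopsAndRobbers.

Definition calG_vertex : Type := {p : nat * nat | p != (0, 0)}.

Definition calG_adj : rel calG_vertex := fun x y =>
  let: (a, b) := val x in
  let: (c, d) := val y in
  (x != y) &&
  [|| (a == 0) && (c == 0), (b == 0) && (d == 0),
      (a < c) && (d < b) | (c < a) && (b < d)].

Lemma calG_adj_sym : symmetric calG_adj.
Proof.
move=> x y; rewrite /calG_adj eq_sym.
case: (val x) (val y) => a b [c d].
by rewrite (andbC (a == 0)) (andbC (b == 0)) [X in [|| _, _ | X]]orbC.
Qed.

Lemma calG_adj_irr : irreflexive calG_adj.
Proof. by move=> x; rewrite /calG_adj eqxx; case: (val x). Qed.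

Definition calG : sgraph := SGraph calG_adj_sym calG_adj_irr.

(* Main.v *)
Require Import Defs.
From mathcomp Require Import all_boot.
From mathcomp Require Import zify.

Set Implicit Arguments.
Unset Strict Implicit.
Unset Printing Implicit Defensive.

(** The cop jumps to a vertex [(0, y)] of the vertical axis, with [y] larger
    than the height of the robber. From there he threatens the whole axis and
    every vertex of height less than [y], so the robber has to increase his
    height, which forces his first coordinate to decrease strictly. If the
    robber starts in column [a], he is thus caught within [a + 2] turns.

    Conversely, the robber is safe as long as he is strictly above and to the
    right of the cop. A cop move that destroys this in one coordinate decreases
    the other one (or keeps it at [0]), so the robber restores the situation by
    overtaking the cop in the first coordinate and giving up just one unit of
    the second, or vice versa. Starting at [(n + 2, n + 2)] he can afford this
    [n] times. *)

Section GameRecursion.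

Variable G : sgraph.
Implicit Types (u v : G) (s : cop_strategy G) (r : nat -> G) (n : nat).

Definition resume s u : cop_strategy G := fun h => s (u :: h).

Lemma cop_posS v s r n :
  cop_pos v s r n.+1 =
  cop_pos (s [:: r 0]) (resume s (r 0)) (r \o succn) n.
Proof.
case: n => // n; rewrite /cop_pos /resume /mkseq map_comp.
by rewrite -[in RHS](iotaDl 1).
Qed.

Lemma caught_within0 v s r : caught_within v s r 0 <-> v = r 0.
Proof.
split=> [[k [[] | []]] // | met]; last by exists 0; left.
by rewrite leqn0 => /eqP->.
Qed.

Lemma caught_withinS v s r n :
  caught_within v s r n.+1 <->
  [\/ v = r 0, s [:: r 0] = r 0 |
      caught_within (s [:: r 0]) (resume s (r 0)) (r \o succn) n].
Proof.
split.
- case=> -[|k] [] [le_kn].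
  + by constructor 1.
  + by constructor 2.
  + by rewrite cop_posS => met; constructor 3; exists k; left.
  + by rewrite cop_posS => met; constructor 3; exists k; right.
- case=> [met | met | [k [] [le_kn met]]].
  + by exists 0; left.
  + by exists 0; right.
  + by exists k.+1; left; rewrite cop_posS.
  + by exists k.+1; right; rewrite cop_posS.
Qed.

Lemma robber_play_const u : robber_play (fun=> u).
Proof. by move=> n; left. Qed.

Lemma robber_play_tail r : robber_play r -> robber_play (r \o succn).
Proof. by move=> play n; apply: play. Qed.

Definition prepend u r n : G := if n is m.+1 then r m else u.

Lemma robber_play_prepend u r :
  move u (r 0) -> robber_play r -> robber_play (prepend u r).
Proof. by move=> ur play [|n] //; apply: play. Qed.

End GameRecursion.

Section PositionalStrategy.

Variables (G : sgraph) (step : G -> G -> G) (rank : G -> G -> nat).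

Hypothesis step_move : forall c r, move c (step c r).

Hypothesis step_progress : forall c r r', move r r' ->
  [\/ step c r = r, step (step c r) r' = r' | rank (step c r) r' < rank c r].

Definition positional (v : G) : cop_strategy G := foldl step v.

Lemma positional_legal (v : G) : legal v (positional v).
Proof.
move=> r play n; elim: n v r play => [|n IHn] v r play; first exact: step_move.
by rewrite !(cop_posS v); apply: IHn (robber_play_tail play).
Qed.

Lemma positional_catch (v : G) (r : nat -> G) :
  robber_play r -> caught_within v (positional v) r (rank v (r 0) + 2).
Proof.
suff catch m : forall v r, robber_play r -> rank v (r 0) < m ->
    caught_within v (positional v) r m.+1.
  by move=> play; rewrite addn2; apply: catch.
elim: m => // m IHm {}v {}r play lt_rank; rewrite caught_withinS.
case: (step_progress v (play 0)) => [met | met | rank_decr].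
- by constructor 2.
- by constructor 3; rewrite caught_withinS; constructor 2.
- constructor 3; apply: IHm (robber_play_tail play) _.
  exact: leq_trans rank_decr lt_rank.
Qed.

Lemma positional_cop_can_catch_within (v u : G) :
  cop_can_catch_within v u (rank v u + 2).
Proof.
exists (positional v); split=> [|r play <-]; first exact: positional_legal.
exact: positional_catch.
Qed.

Lemma positional_cop_win (v : G) : cop_win G.
Proof.
exists v, (positional v); split=> [|r play]; first exact: positional_legal.
by exists (rank v (r 0) + 2); apply: positional_catch.
Qed.

End PositionalStrategy.

Section Evasion.

Variable G : sgraph.

(* Legality is only required against robbers starting at [u]: unlike [legal],
   this is inherited by the strategy for the rest of the game. *)
Definition catches_from (v : G) (s : cop_strategy G) (u : G) (n : nat) : Prop :=
  forall r, robber_play r -> r 0 = u ->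
  (forall k, move (cop_pos v s r k) (cop_pos v s r k.+1)) /\
  caught_within v s r n.

Lemma catches_from_move (v : G) (s : cop_strategy G) (u : G) (n : nat) :
  catches_from v s u n -> move v (s [:: u]).
Proof. by case/(_ _ (robber_play_const u) erefl) => /(_ 0). Qed.

Lemma catches_from_resume (v : G) (s : cop_strategy G) (u u' : G) (n : nat) :
  catches_from v s u n.+1 -> ~ move v u -> move u u' ->
  catches_from (s [:: u]) (resume s u) u' n.
Proof.
move=> catch not_vu uu' r play r0.
have play_u : robber_play (prepend u r).
  by apply: robber_play_prepend; rewrite ?r0.
have [legal_s] := catch _ play_u erefl; rewrite caught_withinS => caught.
split=> [k|]; first by have := legal_s k.+1; rewrite !(cop_posS v).
case: caught => // met; case: not_vu; first by left.
by rewrite -[X in move _ X]met; apply: catches_from_move catch.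
Qed.

Variable safe : nat -> G -> G -> Prop.

Hypothesis safe_not_move : forall n c r, safe n c r -> ~ move c r.

Hypothesis safe_reply : forall n c c' r, safe n.+1 c r -> move c c' ->
  exists2 r', move r r' & safe n c' r'.

Lemma safe_not_catches_from (n : nat) (v : G) (s : cop_strategy G) (u : G) :
  safe n v u -> ~ catches_from v s u n.
Proof.
elim: n v s u => [|n IHn] v s u safe_u catch.
  have [_ /caught_within0 met] := catch _ (robber_play_const u) erefl.
  by apply: safe_not_move safe_u _; left.
have [u' uu' safe_u'] := safe_reply safe_u (catches_from_move catch).
apply: IHn safe_u' _.
exact: catches_from_resume catch (safe_not_move safe_u) uu'.
Qed.

Lemma safe_not_cop_can_catch_within (n : nat) (v u : G) :
  safe n v u -> ~ cop_can_catch_within v u n.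
Proof.
move=> safe_u [s [legal_s catch]].
apply: (@safe_not_catches_from n v s u) => // r play r0.
by split; [apply: legal_s | apply: catch].
Qed.

End Evasion.

Definition col (p : calG_vertex) : nat := (val p).1.
Definition row (p : calG_vertex) : nat := (val p).2.

Lemma calG_eqP (p q : calG_vertex) : p = q <-> col p = col q /\ row p = row q.
Proof.
split=> [-> // | [eq_col eq_row]]; apply: val_inj.
by apply/eqP/andP; split; apply/eqP.
Qed.

Lemma calG_moveP (p q : calG) : move p q <->
  (col p = col q /\ row p = row q) \/ (col p = 0 /\ col q = 0) \/
  (row p = 0 /\ row q = 0) \/ (col p < col q /\ row q < row p) \/
  (col q < col p /\ row p < row q).
Proof.
rewrite /move calG_eqP /= /calG_adj; have [-> | neq_pq] := eqVneq p q.
  by split=> _; left.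
rewrite /col /row; case: (val p) (val q) => a b [c d] /=.
by lia.
Qed.

Lemma pair_neq0 (a b : nat) : 0 < a + b -> (a, b) != (0, 0).
Proof. by rewrite xpair_eqE -addn_eq0 lt0n. Qed.

Definition vertex_at (a b : nat) (ab_gt0 : 0 < a + b) : calG :=
  exist _ (a, b) (pair_neq0 ab_gt0).

Lemma vertex_atE (a b : nat) (ab_gt0 : 0 < a + b) :
  (col (vertex_at ab_gt0) = a) * (row (vertex_at ab_gt0) = b).
Proof. by []. Qed.

Definition axis_vertex (n : nat) : calG := @vertex_at 0 n.+1 isT.

Definition reaches (p q : calG_vertex) : bool := (p == q) || calG_adj p q.

Lemma reachesP (p q : calG) : reflect (move p q) (reaches p q).
Proof. by apply: (iffP orP) => -[/eqP|]; [left | right | left | right]. Qed.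

Definition chase (c r : calG) : calG :=
  if reaches c r then r else axis_vertex (row c + row r).

Lemma chase_move (c r : calG) : move c (chase c r).
Proof.
rewrite /chase; case: reachesP => // _; apply/calG_moveP.
by rewrite !vertex_atE; lia.
Qed.

Lemma chase_capture (c r : calG) : move c r -> chase c r = r.
Proof. by rewrite /chase => /reachesP->. Qed.

Lemma axis_vertex_escape (n : nat) (r r' : calG) :
  row r <= n -> move r r' -> ~ move (axis_vertex n) r' -> col r' < col r.
Proof. by rewrite !calG_moveP !vertex_atE; lia. Qed.

Lemma chase_progress (c r r' : calG) : move r r' ->
  [\/ chase c r = r, chase (chase c r) r' = r' | col r' < col r].
Proof.
move=> rr'; have [/chase_capture | not_cr] := reachesP c r.
  by constructor 1.
have [/chase_capture | ] := reachesP (chase c r) r'; first by constructor 2.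
rewrite {1}/chase; case: reachesP => // _ escape; constructor 3.
exact: axis_vertex_escape (leq_addl _ _) rr' escape.
Qed.

Definition dominates (k : nat) (c r : calG) : Prop :=
  [/\ col c < col r, row c < row r, k < col r & k < row r].

Lemma dominates_not_move (k : nat) (c r : calG) :
  dominates k c r -> ~ move c r.
Proof. by case=> ? ? _ _ /calG_moveP; lia. Qed.

Lemma dominates_reply (k : nat) (c c' r : calG) :
  dominates k.+1 c r -> move c c' ->
  exists2 r', move r r' & dominates k c' r'.
Proof.
case=> lt_col lt_row k_col k_row /calG_moveP cc'.
have [overtaken_col | lt_col'] := leqP (col r) (col c').
  exists (@vertex_at (col c').+1 (row r).-1 isT).
    by apply/calG_moveP; rewrite !vertex_atE; lia.
  by split; rewrite !vertex_atE; lia.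
have [overtaken_row | lt_row'] := leqP (row r) (row c').
  exists (vertex_at (ltn_addl (col r).-1 (ltn0Sn (row c')))).
    by apply/calG_moveP; rewrite !vertex_atE; lia.
  by split; rewrite !vertex_atE; lia.
by exists r; [left | split; lia].
Qed.

Theorem theorem1 :
  cop_win calG /\
  (forall u v : calG, exists n : nat, cop_can_catch_within v u n) /\
  ~ (exists n : nat, forall u v : calG, cop_can_catch_within v u n).
Proof.
split; [|split=> [u v | [n catch]]].
- exact: positional_cop_win chase_move chase_progress (axis_vertex 0).
- exists (col u + 2).
  exact: positional_cop_can_catch_within chase_move chase_progress v u.
- have /(safe_not_cop_can_catch_within dominates_not_move dominates_reply) :
      dominates n (axis_vertex 0) (@vertex_at n.+2 n.+2 isT).
    by split; rewrite !vertex_atE.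
  by apply; apply: catch.
Qed.
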